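(* For every integer $n\ge 3$, $$|\mathcal{M}_1(P(n))|=\begin{cases}2 & \text{if } n=4,\\[4pt] \displaystyle\sum_{\substack{0\le l\le n\\ n-l\equiv 0\ (\mathrm{mod}\ 4)}} \frac{n}{\,l+\frac{n-l}{4}\,}\binom{l+\frac{n-l}{4}}{l} & \text{otherwise.}\end{cases}$$
   Context: For $n\ge 3$, $P(n)=P(n,2)$ is the simple graph with vertex set $\{u_i,v_i:0\le i\le n-1\}$ and edge set $\{u_iu_{i+2},\,u_iv_i,\,v_iv_{i+1}:0\le i\le n-1\}$, subscripts modulo $n$. The edges $u_iv_i$ are called spokes. For $n\neq 4$, $\mathcal{M}_1(P(n))$ is the set of perfect matchings $M$ of $P(n)$ such that either (i) $M$ contains at least one spoke, and for any two (cyclically) consecutive spokes $u_iv_i,u_jv_j$ of $M$ the number of spokes $u_kv_k$ of $P(n)$ strictly between them, $j-i-1$ (with $j$ taken as the representative in $(i,i+n]$), is $\equiv 0\pmod 4$ (if $M$ has exactly one spoke $u_iv_i$, it is regarded as two consecutive spokes with $j=i+n$, so the number is $n-1$); or (ii) $M$ contains no spoke, $4\mid n$, and for some $i$, $M=\bigcup_{k=0}^{n/4-1}\{u_{i+4k}u_{i+4k+2},\,u_{i+4k+1}u_{i+4k+3},\,v_{i+4k}v_{i+4k+1},\,v_{i+4k+2}v_{i+4k+3}\}$. For $n=4$, $\mathcal{M}_1(P(4))$ consists of the two perfect matchings $\{u_iv_i:0\le i\le 3\}$ and $\{u_0u_2,u_1u_3,v_0v_1,v_2v_3\}$. *)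

(* Defs.v *)
From HB Require Import structures.
From mathcomp Require Import all_boot all_order all_algebra.

Set Implicit Arguments.
Unset Strict Implicit.
Unset Printing Implicit Defensive.

Definition perfect_matching (V : finType) (E M : {set {set V}}) : bool :=
  [&& M \subset E, trivIset M & cover M == [set: V]].

(* The index i + k modulo n. *)
Definition shift (n : nat) (i : 'I_n) (k : nat) : 'I_n := iter k (@ordS n) i.

Definition vertex (n : nat) : finType := ('I_n + 'I_n)%type.

Definition u (n : nat) (i : 'I_n) : vertex n := inl i.
Definition v (n : nat) (i : 'I_n) : vertex n := inr i.

Definition spoke (n : nat) (i : 'I_n) : {set vertex n} := [set u i; v i].

(* The edge set of P(n, 2).  Edges are unordered pairs {x, y}; they are proper
   pairs only for n >= 3. *)
Definition P_edges (n : nat) : {set {set vertex n}} :=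
  [set [set u i; u (shift i 2)] | i : 'I_n]
  :|: [set spoke i | i : 'I_n]
  :|: [set [set v i; v (shift i 1)] | i : 'I_n].

(* The spokes of M at i and at j = i + g + 1 are cyclically consecutive, with
   exactly g = j - i - 1 spokes of P(n) strictly between them.  For g < n the
   representative j ranges over (i, i + n]; if M has a single spoke u_i v_i, the
   only such g is n - 1. *)
Definition consecutive_spokes (n : nat) (M : {set {set vertex n}})
    (i : 'I_n) (g : nat) : bool :=
  [&& spoke i \in M, spoke (shift i g.+1) \in M &
      [forall k : 'I_g, spoke (shift i k.+1) \notin M]].

Definition type_i (n : nat) (M : {set {set vertex n}}) : bool :=
  [exists i : 'I_n, spoke i \in M] &&
  [forall i : 'I_n, forall g : 'I_n, consecutive_spokes M i g ==> (4 %| g)].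

Definition type_ii_matching (n : nat) (i : 'I_n) : {set {set vertex n}} :=
  \bigcup_(k < n %/ 4)
    [set [set u (shift i (4 * k)); u (shift i (4 * k + 2))];
         [set u (shift i (4 * k + 1)); u (shift i (4 * k + 3))];
         [set v (shift i (4 * k)); v (shift i (4 * k + 1))];
         [set v (shift i (4 * k + 2)); v (shift i (4 * k + 3))]].

Definition type_ii (n : nat) (M : {set {set vertex n}}) : bool :=
  [&& [forall i : 'I_n, spoke i \notin M], 4 %| n &
      [exists i : 'I_n, M == type_ii_matching i]].

Definition M1_4 : {set {set {set vertex 4}}} :=
  let u_ k := u (inord k : 'I_4) in
  let v_ k := v (inord k : 'I_4) in
  [set [set spoke i | i : 'I_4];
       [set [set u_ 0; u_ 2]; [set u_ 1; u_ 3];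
            [set v_ 0; v_ 1]; [set v_ 2; v_ 3]]].

Definition M1 (n : nat) : {set {set {set vertex n}}} :=
  match n with
  | 4 => M1_4
  | m => [set M : {set {set vertex m}} |
           perfect_matching (P_edges m) M && (type_i M || type_ii M)]
  end.

(* Main.v *)
Require Import Defs.
From HB Require Import structures.
From mathcomp Require Import all_boot all_order all_algebra.
From mathcomp Require Import ring zify.
Import GRing.Theory Num.Theory.
Local Open Scope ring_scope.

Set Implicit Arguments.
Unset Strict Implicit.
Unset Printing Implicit Defensive.

(* For n <> 4 the matchings of M1 correspond to the tilings of the cycle Z_n by
   monomers and 4-tiles: a monomer at x stands for the spoke at x, and a 4-tile
   on {a, ..., a + 3} for the edges u_a u_(a+2), u_(a+1) u_(a+3), v_a v_(a+1),
   v_(a+2) v_(a+3).  For surjectivity on type (i), the spokes of M determine the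
   tiling; going around the v-cycle by steps of 1, and the u-cycles by steps
   of 2, the spokes then determine M, because two consecutive spokes are at an
   odd distance, so that each u-cycle contains a spoke.

   There are 'C(l + m, l) tilings by l monomers and m 4-tiles in which a tile
   begins at a given point, and each tiling has l + m tiles; double counting the
   pairs (tiling, beginning of a tile) gives n / (l + m) * 'C(l + m, l). *)

(** * Perfect matchings in terms of vertex degrees *)

Lemma perfect_matchingP (V : finType) (E M : {set {set V}}) :
  reflect (M \subset E /\ forall w, #|[set B in M | w \in B]| = 1%N)
          (perfect_matching E M).
Proof.
apply: (iffP and3P) => [[sME tM /eqP cM]|[sME M1]].
  split=> // w; have: w \in cover M by rewrite cM inE.
  case/bigcupP=> B BM wB; apply/eqP/cards1P; exists B; apply/setP=> C.
  rewrite !inE; apply/andP/eqP=> [[CM wC]|->//]; apply/eqP/negPn/negP=> nCB.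
  by have /disjointFr/(_ wC) := trivIsetP tM _ _ CM BM nCB; rewrite wB.
split=> //.
  apply/trivIsetP=> B C BM CM; apply: contraNT => /pred0Pn[w /andP[/= wB wC]].
  have /eqP/cards1P[D eD] := M1 w.
  have: B \in [set D] by rewrite -eD inE BM.
  have: C \in [set D] by rewrite -eD inE CM.
  by rewrite !inE => /eqP-> /eqP->.
apply/eqP/setP=> w; rewrite inE.
have /eqP/cards1P[D eD] := M1 w.
have: D \in [set B in M | w \in B] by rewrite eD inE.
by rewrite inE => /andP[DM wD]; apply/bigcupP; exists D.
Qed.

Definition u_edge (n : nat) (x : 'I_n) : {set vertex n} :=
  [set u x; u (shift x 2)].

Definition v_edge (n : nat) (x : 'I_n) : {set vertex n} :=
  [set v x; v (shift x 1)].

(** * The edges of P(n), indexed by the ring Z/n *)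

Section Cycle.

Variable p : nat.
Implicit Types (x y : 'I_p.+3) (A : {set 'I_p.+3}).

Lemma ord_natrE k : nat_of_ord (k%:R : 'I_p.+3) = (k %% p.+3)%N.
Proof. by rewrite Zp_nat. Qed.

Lemma ord_natr_eq0 k : (k%:R == 0 :> 'I_p.+3) = (p.+3 %| k)%N.
Proof. by rewrite -val_eqE /= ord_natrE. Qed.

(** With n written as [p.+3], the indices carry the ring structure of Z/n, so that identities
    between them fall to [ring]. *)
Lemma shiftE x k : shift x k = x + k%:R.
Proof.
elim: k => [|k IHk]; first by rewrite addr0.
rewrite /shift iterS -/(shift x k) IHk mulrS [1 + _]addrC addrA.
by apply: val_inj; rewrite /= modnDmr addn1.
Qed.

Lemma ord_cycle x y : {k | (k < p.+3)%N & y = x + k%:R}.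
Proof.
exists (nat_of_ord (y - x)); first exact: ltn_ord.
by rewrite natr_Zp addrC subrK.
Qed.

Lemma ord_natrD_n k : (k + p.+3)%:R = k%:R :> 'I_p.+3.
Proof. by apply: val_inj; rewrite /= !ord_natrE modnDr. Qed.

Lemma in_uu x y : (u x \in u_edge y) = (x == y) || (x == y + 2).
Proof. by rewrite !inE shiftE. Qed.

Lemma in_uv x y : (u x \in v_edge y) = false.
Proof. by rewrite !inE. Qed.

Lemma in_vu x y : (v x \in u_edge y) = false.
Proof. by rewrite !inE. Qed.

Lemma in_vv x y : (v x \in v_edge y) = (x == y) || (x == y + 1).
Proof. by rewrite !inE shiftE. Qed.

Lemma in_us x y : (u x \in spoke y) = (x == y).
Proof. by rewrite !inE orbF. Qed.

Lemma in_vs x y : (v x \in spoke y) = (x == y).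
Proof. by rewrite !inE. Qed.

Definition in_edgeE := (in_uu, in_uv, in_vu, in_vv, in_us, in_vs).

Lemma in_P_edges (B : {set vertex p.+3}) :
  reflect (exists x, [\/ B = u_edge x, B = spoke x | B = v_edge x])
          (B \in P_edges p.+3).
Proof.
rewrite /P_edges !inE -orbA; apply: (iffP or3P).
  by case=> /imsetP[x _ ->]; exists x; [apply: Or31|apply: Or32|apply: Or33].
by case=> x [->|->|->]; [apply: Or31|apply: Or32|apply: Or33]; apply: imset_f.
Qed.

Lemma spoke_inj : injective (@spoke p.+3).
Proof. by move=> x y e; apply/eqP; rewrite -in_us -e in_us. Qed.

Lemma ord_small_neq0 k : (0 < k < p.+3)%N -> (k%:R == 0 :> 'I_p.+3) = false.
Proof. by case/andP=> k0 kn; rewrite ord_natr_eq0 gtnNdvd. Qed.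

Lemma ord_addr_neq x y k : (0 < k < p.+3)%N -> x = y + k%:R -> (x == y) = false.
Proof. by move=> /ord_small_neq0 k0 ->; rewrite -subr_eq0 addrC addKr k0. Qed.

Lemma v_edge_inj : injective (@v_edge p.+3).
Proof.
move=> x y e.
have: v x \in v_edge y by rewrite -e !in_edgeE eqxx.
have: v y \in v_edge x by rewrite e !in_edgeE eqxx.
rewrite !in_edgeE => /orP[/eqP->//|/eqP ->] /orP[/eqP<-//|].
by rewrite eq_sym (@ord_addr_neq _ _ 2) //; ring.
Qed.

(** Distinct x and y with the same edge would each be the other plus 2, so 4 = 0 in Z/n; for n >= 3
    this means n = 4. *)
Lemma u_edge_inj : p != 1%N -> injective (@u_edge p.+3).
Proof.
move=> p1 x y e.
have: u x \in u_edge y by rewrite -e !in_edgeE eqxx.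
have: u y \in u_edge x by rewrite e !in_edgeE eqxx.
rewrite !in_edgeE => /orP[/eqP->//|/eqP ->] /orP[/eqP<-//|].
rewrite -subr_eq0 (_ : _ - _ = - 4%:R); last by ring.
rewrite oppr_eq0 ord_natr_eq0 => p4; case/negP: p1.
by case: (p) p4 => [|[|q]].
Qed.

Lemma spoke_u_edge x y : (spoke x == u_edge y) = false.
Proof. by apply/eqP => /setP/(_ (v x)); rewrite !in_edgeE eqxx. Qed.

Lemma spoke_v_edge x y : (spoke x == v_edge y) = false.
Proof. by apply/eqP => /setP/(_ (u x)); rewrite !in_edgeE eqxx. Qed.

Lemma u_v_edge x y : (u_edge x == v_edge y) = false.
Proof. by apply/eqP => /setP/(_ (u x)); rewrite !in_edgeE eqxx. Qed.

(** Applied with [r] the three edges at a vertex, to write its degree in [M] as a sum of three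
    booleans. *)
Lemma card_mem_uniq (T : finType) (M : {set T}) (P : pred T) (r : seq T) :
  uniq r -> (forall B, B \in M -> P B = (B \in r)) ->
  #|[set B in M | P B]| = count (mem M) r.
Proof.
move=> ur Pr; rewrite -size_filter -(card_uniqP (filter_uniq (mem M) ur)).
apply: eq_card => B; rewrite !inE mem_filter; case BM: (B \in M) => //=.
  by rewrite Pr // BM.
by rewrite [X in X && _]BM.
Qed.

(** P(n) is cubic: each sum runs over the three edges at u_x, respectively at v_x, which are
    distinct because n <> 4. *)
Lemma perfect_matching_degP (M : {set {set vertex p.+3}}) : p != 1%N ->
  reflect (M \subset P_edges p.+3 /\ forall x,
    ((spoke x \in M) + (u_edge x \in M) + (u_edge (x - 2)%R \in M) = 1)%N /\
    ((spoke x \in M) + (v_edge x \in M) + (v_edge (x - 1)%R \in M) = 1)%N)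
  (perfect_matching (P_edges p.+3) M).
Proof.
move=> p1; have [sME|nsM] := boolP (M \subset P_edges p.+3); last first.
  by rewrite /perfect_matching (negPf nsM); constructor; case.
have Eu x : #|[set B in M | u x \in B]| =
    ((spoke x \in M) + (u_edge x \in M) + (u_edge (x - 2)%R \in M))%N.
  rewrite (@card_mem_uniq _ _ _ [:: spoke x; u_edge x; u_edge (x - 2)]).
  - by rewrite /= addn0 addnA.
  - rewrite /= !in_cons !in_nil !spoke_u_edge /= andbT (inj_eq (u_edge_inj p1)).
    by rewrite (@ord_addr_neq _ _ 2) //; ring.
  move=> B /(subsetP sME)/in_P_edges[y [] ->];
    rewrite !in_cons in_nil !in_edgeE.
  - rewrite !(inj_eq (u_edge_inj p1)) eq_sym [u_edge y == _]eq_sym.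
    by rewrite spoke_u_edge [y == x - 2]eq_sym subr_eq orbF.
  - by rewrite !spoke_u_edge (inj_eq spoke_inj) eq_sym !orbF.
  - by rewrite ![v_edge y == _]eq_sym spoke_v_edge !u_v_edge.
have Ev x : #|[set B in M | v x \in B]| =
    ((spoke x \in M) + (v_edge x \in M) + (v_edge (x - 1)%R \in M))%N.
  rewrite (@card_mem_uniq _ _ _ [:: spoke x; v_edge x; v_edge (x - 1)]).
  - by rewrite /= addn0 addnA.
  - rewrite /= !in_cons !in_nil !spoke_v_edge /= andbT (inj_eq v_edge_inj).
    by rewrite (@ord_addr_neq _ _ 1) //; ring.
  move=> B /(subsetP sME)/in_P_edges[y [] ->];
    rewrite !in_cons in_nil !in_edgeE.
  - by rewrite [u_edge y == _]eq_sym spoke_u_edge !u_v_edge.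
  - by rewrite !spoke_v_edge (inj_eq spoke_inj) eq_sym !orbF.
  - rewrite !(inj_eq v_edge_inj) [v_edge y == _]eq_sym.
    by rewrite spoke_v_edge [y == x]eq_sym [y == x - 1]eq_sym subr_eq orbF.
apply: (iffP (perfect_matchingP _ _)) => -[_ H]; split=> //.
  by move=> x; rewrite -Eu -Ev.
by case=> x; [rewrite Eu; case: (H x)|rewrite Ev; case: (H x)].
Qed.

End Cycle.

(** * Tilings of the cycle by monomers and 4-tiles *)

Section Tilings.

Variable p : nat.
Implicit Types (x y : 'I_p.+3) (A : {set 'I_p.+3}).

(* [A] is the set of the starting points of the 4-tiles, a 4-tile at [a]
   occupying [a], ..., [a + 3]. *)
Definition tiling A : bool :=
  [forall x in A, [&& x + 1 \notin A, x + 2 \notin A & x + 3 \notin A]].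

(* No 4-tile covers both [x - 1] and [x]. *)
Definition boundary A x : bool :=
  [&& x - 1 \notin A, x - 2 \notin A & x - 3 \notin A].

Definition monomers A : {set 'I_p.+3} := [set x | (x \notin A) && boundary A x].

(** Read from the index of an edge: [u_edge x] comes from a 4-tile at x or x - 1, and [v_edge x]
    from one at x or x - 2. *)
Definition tiling_matching A : {set {set vertex p.+3}} :=
  [set spoke x | x in monomers A]
  :|: [set u_edge x | x in [set x | (x \in A) || (x - 1 \in A)]]
  :|: [set v_edge x | x in [set x | (x \in A) || (x - 2 \in A)]].

Lemma tilingP A : reflect
  (forall x, x \in A -> [/\ x + 1 \notin A, x + 2 \notin A & x + 3 \notin A])
  (tiling A).
Proof.
by apply: (iffP forall_inP) => H x xA; [apply/and3P|apply/and3P]; apply: H.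
Qed.

(** Each cell lies in exactly one tile: a monomer, or a 4-tile starting at most three cells back.
    Two such starts would be too close for [tiling]. *)
Lemma tiling_cover A x : tiling A ->
  ((x \in monomers A) + (x \in A) + (x - 1 \in A)%R + (x - 2 \in A)%R
    + (x - 3 \in A)%R = 1)%N.
Proof.
move=> /tilingP tA; rewrite !inE /boundary.
have H (b c : bool) : (b -> ~~ c) -> ~~ (b && c) by case: b; case: c => // ->.
have e1 y : y - 1 + 1 = y by ring.
have e2 y : y - 2 + 2 = y by ring.
have e3 y : y - 3 + 3 = y by ring.
have e21 : x - 2 + 1 = x - 1 by ring.
have e31 : x - 3 + 1 = x - 2 by ring.
have e32 : x - 3 + 2 = x - 1 by ring.
have := tA (x - 1); have := tA (x - 2); have := tA (x - 3).
rewrite e1 e2 e3 e21 e31 e32.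
case: (x \in A); case: (x - 1 \in A); case: (x - 2 \in A); case: (x - 3 \in A);
  by do ?[case/(_ isT) => //|move=> _].
Qed.

Lemma tiling_boundary A x : tiling A -> x \in A -> boundary A x.
Proof.
move=> tA xA; have := tiling_cover x tA; rewrite xA /boundary.
by case: (x - 1 \in A); case: (x - 2 \in A); case: (x - 3 \in A);
  case: (x \in monomers A).
Qed.

Lemma tiling_boundary4 A x : tiling A -> x \in A -> boundary A (x + 4).
Proof.
move=> /tilingP tA /tA[x1 x2 x3]; rewrite /boundary.
rewrite (_ : x + 4 - 1 = x + 3); last by ring.
rewrite (_ : x + 4 - 2 = x + 2); last by ring.
rewrite (_ : x + 4 - 3 = x + 1); last by ring.
by rewrite x1 x2 x3.
Qed.

(** A boundary cell that is no monomer starts a 4-tile, whose end is again a boundary; so 4-tiles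
    follow one another as long as no monomer is met. *)
Lemma tiling_run A x g q : tiling A -> boundary A x ->
  (forall k, (k < g)%N -> x + k%:R \notin monomers A) -> (4 * q <= g)%N ->
  boundary A (x + (4 * q)%:R) /\ ((4 * q < g)%N -> x + (4 * q)%:R \in A).
Proof.
move=> tA fx nm; elim: q => [|q IHq] qg.
  rewrite muln0 addr0; split=> // g0; have := nm _ g0.
  by rewrite addr0 inE fx andbT negbK.
have lqg : (4 * q < g)%N by lia.
case: (IHq (ltnW lqg)) => _ /(_ lqg)/(tiling_boundary4 tA).
rewrite -addrA -natrD -mulnSr => fq; split=> // lqg'.
by have := nm _ lqg'; rewrite inE fq andbT negbK.
Qed.

Lemma not_monomer A x k : (k < 4)%N -> x \in A -> x + k%:R \notin monomers A.
Proof.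
move=> k4 xA; rewrite inE /boundary.
case: k k4 => [|[|[|[|//]]]] _; rewrite ?addr0 ?addrK ?xA ?andbF //.
Qed.

(** If 4 did not divide g, the 4-tile starting at the last multiple of 4 below g would cover the
    monomer x + g. *)
Lemma tiling_gap A x g : tiling A -> boundary A x ->
  (forall k, (k < g)%N -> x + k%:R \notin monomers A) ->
  x + g%:R \in monomers A -> (4 %| g)%N.
Proof.
move=> tA fx nm mg; have [|_ H] := tiling_run (q := g %/ 4) tA fx nm.
  by rewrite mulnC leq_divM.
apply: contraLR mg => n4g.
have eg := divn_eq g 4; rewrite mulnC in eg.
have r0 : (0 < g %% 4)%N by rewrite lt0n.
rewrite {1}eg natrD addrA not_monomer ?ltn_mod // H //.
by rewrite {2}eg -addn1 leq_add2l.
Qed.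

Lemma tiling_no_monomer A x k : tiling A -> monomers A = set0 -> x \in A ->
  (x + k%:R \in A) = (4 %| k)%N.
Proof.
move=> tA m0 xA.
(* The length k + 1 lets the run include the start at offset [4 * (k %/ 4)], of the 4-tile covering
   x + k. *)
have [] := @tiling_run A x k.+1 (k %/ 4) tA (tiling_boundary tA xA).
- by move=> j _; rewrite m0 inE.
- by rewrite mulnC; have := leq_divM k 4; lia.
move=> _ /(_ _) qA; have {}qA : x + (4 * (k %/ 4))%:R \in A.
  by apply: qA; rewrite mulnC ltnS leq_divM.
have ek := divn_eq k 4; rewrite mulnC in ek.
rewrite {1}ek natrD addrA /dvdn.
have /tilingP/(_ _ qA)[/negPf q1 /negPf q2 /negPf q3] := tA.
have := ltn_mod k 4.
by case: (k %% 4)%N => [|[|[|[|//]]]]; rewrite ?addr0.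
Qed.

End Tilings.

(** * The correspondence between tilings and matchings *)

Section Matchings.

Variable p : nat.
Hypothesis p1 : p != 1%N.
Implicit Types (x y : 'I_p.+3) (A : {set 'I_p.+3}).
Implicit Types M N : {set {set vertex p.+3}}.

Lemma notin_imset (T T' : finType) (f : T -> T') (D : {set T}) B :
  (forall t, (f t == B) = false) -> (B \in [set f t | t in D]) = false.
Proof. by move=> H; apply/imsetP => -[t _ /eqP]; rewrite eq_sym H. Qed.

Lemma spoke_tiling A x : (spoke x \in tiling_matching A) = (x \in monomers A).
Proof.
rewrite !in_setU (mem_imset _ _ (@spoke_inj p)).
rewrite !notin_imset ?orbF // => y; rewrite eq_sym.
  exact: spoke_v_edge.
exact: spoke_u_edge.
Qed.

Lemma u_edge_tiling A x :
  (u_edge x \in tiling_matching A) = (x \in A) || (x - 1 \in A).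
Proof.
rewrite !in_setU (mem_imset _ _ (u_edge_inj p1)) inE.
rewrite !notin_imset ?orbF // => y; last exact: spoke_u_edge.
by rewrite eq_sym u_v_edge.
Qed.

Lemma v_edge_tiling A x :
  (v_edge x \in tiling_matching A) = (x \in A) || (x - 2 \in A).
Proof.
rewrite !in_setU (mem_imset _ _ (@v_edge_inj p)) inE.
rewrite !notin_imset ?orbF // => y; [exact: u_v_edge|exact: spoke_v_edge].
Qed.

Definition tilingE := (spoke_tiling, u_edge_tiling, v_edge_tiling).

Lemma eq_matching M N : M \subset P_edges p.+3 -> N \subset P_edges p.+3 ->
  (forall x, [/\ (spoke x \in M) = (spoke x \in N),
     (u_edge x \in M) = (u_edge x \in N) &
     (v_edge x \in M) = (v_edge x \in N)]) -> M = N.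
Proof.
move=> /subsetP sM /subsetP sN H; apply/setP=> B.
have [/in_P_edges[x HB]|nB] := boolP (B \in P_edges p.+3).
  by case: (H x) => [h1 h2 h3]; case: HB => ->.
by rewrite (negPf (contra (sM B) nB)) (negPf (contra (sN B) nB)).
Qed.

Lemma tiling_matching_sub A : tiling_matching A \subset P_edges p.+3.
Proof.
apply/subsetP=> B BA; apply/in_P_edges; move: BA.
rewrite !in_setU -orbA => /or3P[] /imsetP[x _ ->]; exists x;
  [exact: Or32 | exact: Or31 | exact: Or33].
Qed.

(** The degree equations are two groupings of the starts in [tiling_cover]: {x, x - 1} and {x - 2, x
    - 3} at u_x, {x, x - 2} and {x - 1, x - 3} at v_x. *)
Lemma tiling_matching_perfect A :
  tiling A -> perfect_matching (P_edges p.+3) (tiling_matching A).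
Proof.
move=> tA; apply/perfect_matching_degP => //; split=> [|x].
  exact: tiling_matching_sub.
rewrite !tilingE.
rewrite (_ : x - 2 - 1 = x - 3); last by ring.
rewrite (_ : x - 1 - 2 = x - 3); last by ring.
have := tiling_cover x tA.
by case: (x \in A); case: (x - 1 \in A); case: (x - 2 \in A);
  case: (x - 3 \in A); case: (x \in monomers A).
Qed.

(** At most one 4-tile covers x; the u-edge puts its start in {x, x - 1}, the v-edge in {x, x - 2},
    hence at x. *)
Lemma tiling_of_matching A x : tiling A -> (x \in A) =
  (u_edge x \in tiling_matching A) && (v_edge x \in tiling_matching A).
Proof.
move=> tA; rewrite !tilingE; have := tiling_cover x tA.
by case: (x \in A); case: (x - 1 \in A); case: (x - 2 \in A);
  case: (x - 3 \in A); case: (x \in monomers A).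
Qed.

Lemma tiling_matching_inj :
  {in [pred A | tiling A] &, injective (@tiling_matching p)}.
Proof.
move=> A A'; rewrite !inE => tA tA' e; apply/setP=> x.
by rewrite !tiling_of_matching // e.
Qed.

Lemma tiling_type_i A :
  tiling A -> monomers A != set0 -> type_i (tiling_matching A).
Proof.
move=> tA /set0Pn[x0 mx0]; apply/andP; split.
  by apply/existsP; exists x0; rewrite spoke_tiling.
suff H (x g : 'I_p.+3) :
    consecutive_spokes (tiling_matching A) x g -> (4 %| g)%N.
  by apply/forallP=> x; apply/forallP=> g; apply/implyP; apply: H.
case/and3P.
rewrite !spoke_tiling shiftE => mx mxg /forallP H.
(* The run of 4-tiles begins at x + 1, a boundary because x is a monomer. *)
apply: (@tiling_gap _ A (x + 1) g tA).
- move: mx; rewrite inE => /andP[xA /and3P[x1 x2 x3]].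
  rewrite /boundary (_ : x + 1 - 1 = x); last by ring.
  rewrite (_ : x + 1 - 2 = x - 1); last by ring.
  rewrite (_ : x + 1 - 3 = x - 2); last by ring.
  by rewrite xA x1 x2.
- move=> k kg; have := H (Ordinal kg).
  by rewrite spoke_tiling shiftE /= mulrS addrA.
by move: mxg; rewrite mulrS addrA.
Qed.

(** The starts of the 4-tiles of a type (ii) matching. When 4 divides n, the residue modulo 4 does
    not depend on the representative of x - i. *)
Definition periodic (i : 'I_p.+3) : {set 'I_p.+3} :=
  [set x | (4 %| nat_of_ord (x - i)%R)%N].

Lemma mem_periodic i k :
  (4 %| p.+3)%N -> (i + k%:R \in periodic i) = (4 %| k)%N.
Proof.
by move=> n4; rewrite inE addrC addKr ord_natrE /dvdn modn_dvdm.
Qed.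

(** The extra 3 keeps truncated subtraction exact for the offsets occurring in [boundary]. *)
Lemma ord_cycle3 x y : exists k, y = x + (k + 3)%:R.
Proof.
have [k _ e] := ord_cycle x (y - 3).
by exists k; rewrite natrD addrA -e subrK.
Qed.

Lemma mem_periodicB i k j : (j <= 3)%N ->
  (4 %| p.+3)%N -> (i + (k + 3)%:R - j%:R \in periodic i) = (4 %| k + 3 - j)%N.
Proof.
move=> j3 n4; rewrite -(mem_periodic i) // natrB ?addrA //.
exact: leq_trans j3 (leq_addl _ _).
Qed.

Lemma periodic_tiling i : (4 %| p.+3)%N -> tiling (periodic i).
Proof.
move=> n4; apply/tilingP=> x; have [k _ ->] := ord_cycle i x.
by rewrite -!addrA natr1 -!natrD !mem_periodic // => k4; split; lia.
Qed.

Lemma periodic_monomers i : (4 %| p.+3)%N -> monomers (periodic i) = set0.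
Proof.
move=> n4; apply/setP=> x; rewrite in_set0 in_set /boundary.
have [k ->] := ord_cycle3 i x; rewrite mem_periodic //.
rewrite (@mem_periodicB i k 1) // !mem_periodicB //; lia.
Qed.

Lemma type_ii_matchingE i :
  (4 %| p.+3)%N -> type_ii_matching i = tiling_matching (periodic i).
Proof.
move=> n4.
have U k : [set u (shift i k); u (shift i (k + 2))] = u_edge (i + k%:R).
  by rewrite /u_edge !shiftE natrD addrA.
have V k : [set v (shift i k); v (shift i k.+1)] = v_edge (i + k%:R).
  by rewrite /v_edge !shiftE -natr1 addrA.
apply/setP=> B; apply/bigcupP/idP=> [[k _ Bk]|].
  have k4 := dvdn_mulr k (dvdnn 4).
  rewrite !inE -!orbA (U (4 * k)%N) addn1 V in Bk.
  rewrite (_ : 4 * k + 3 = (4 * k).+1 + 2)%N ?(U (4 * k).+1) in Bk; last lia.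
  rewrite (_ : (4 * k).+1 + 2 = (4 * k + 2).+1)%N ?V in Bk; last lia.
  case/or4P: Bk => /eqP->; rewrite !tilingE mem_periodic //; last 1 first.
  - by rewrite natrD addrA addrK mem_periodic // k4 orbT.
  - by rewrite k4.
  - by rewrite -natr1 addrA addrK mem_periodic // k4 orbT.
  - by rewrite k4.
have inS y : y \in periodic i ->
    exists2 k : 'I_(p.+3 %/ 4), true & y = i + (4 * k)%:R.
  have [m mn ->] := ord_cycle i y; rewrite mem_periodic // => m4.
  have kn : (m %/ 4 < p.+3 %/ 4)%N by lia.
  by exists (Ordinal kn) => //=; rewrite mulnC divnK.
rewrite /tiling_matching !in_setU periodic_monomers // imset0 in_set0 /=.
case/orP=> /imsetP[x]; rewrite in_set.
- case/orP=> /inS[k _ e] ->; exists k => //; rewrite !inE.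
    by rewrite U e eqxx.
  rewrite (_ : 4 * k + 3 = 4 * k + 1 + 2)%N ?U; last lia.
  by rewrite natrD addrA -e subrK eqxx orbT.
- case/orP=> /inS[k _ e] ->; exists k => //; rewrite !inE addn1 V.
    by rewrite e eqxx !orbT.
  rewrite (_ : 4 * k + 3 = (4 * k + 2).+1)%N ?V; last lia.
  by rewrite natrD addrA -e subrK eqxx !orbT.
Qed.

(** [d x] is the number of steps from x back to the nearest element of [S], x itself included. *)
Lemma last_spoke (S : {set 'I_p.+3}) : S != set0 -> exists d : 'I_p.+3 -> nat,
  [/\ forall x, (d x < p.+3)%N, forall x, x - (d x)%:R \in S
    & forall x k, (k < d x)%N -> x - k%:R \notin S].
Proof.
case/set0Pn=> z zS.
have exd (x : 'I_p.+3) : exists k, x - k%:R \in S.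
  by have [k _ ->] := ord_cycle z x; exists k; rewrite addrK.
exists (fun x => ex_minn (exd x)); split=> [x|x|x k]; case: ex_minnP => m //.
  move=> _ Hm; have [k kn e] := ord_cycle z x.
  by apply: leq_ltn_trans kn; apply: Hm; rewrite e addrK.
by move=> _ Hm; apply: contraL => /Hm; rewrite leqNgt.
Qed.

(** Type (i) made local: [d] is 0 at a spoke, grows by one elsewhere, and just before a spoke equals
    the length of the gap, a multiple of 4. *)
Lemma dist_last_spoke (M : {set {set vertex p.+3}}) : type_i M ->
  exists d : 'I_p.+3 -> nat,
  [/\ forall x, (d x == 0) = (spoke x \in M),
      forall x, spoke (x + 1) \notin M -> d (x + 1) = (d x).+1,
      forall x, spoke (x - (d x)%:R) \in M
    & forall x, spoke (x + 1) \in M -> (4 %| d x)%N].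
Proof.
case/andP=> /existsP[z zM] /forallP tM.
have [|d [dn dS dmin]] := @last_spoke [set x | spoke x \in M].
  by apply/set0Pn; exists z; rewrite inE.
exists d; split=> [x|x xM|x|x xM].
- have := dS x; rewrite inE; case: (d x) (dmin x) => [|m] H; rewrite ?subr0 //.
  by have := H 0%N isT; rewrite subr0 inE => /negPf.
- have := dS (x + 1); case: (d (x + 1)) (dmin (x + 1)) => [|m] Hm.
    by rewrite subr0 inE (negPf xM).
  have shf j : x + 1 - j.+1%:R = x - j%:R by rewrite -natr1; ring.
  rewrite shf => Sm; case: (ltngtP m (d x)) => [/dmin|lt|->//].
    by rewrite Sm.
  by have := Hm (d x).+1 lt; rewrite shf dS.
- by have := dS x; rewrite inE.
(* The consecutive spokes are those at x - d x and x + 1, with gap d x; minimality of d x excludes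
   any spoke between them. *)
have /forallP/(_ (Ordinal (dn x)))/implyP := tM (x - (d x)%:R); apply.
apply/and3P; split; first by have := dS x; rewrite inE.
  by rewrite shiftE /= -natr1 addrA subrK.
apply/forallP=> k; have := dmin x (d x - k.+1)%N.
rewrite inE shiftE natrB; last by case: k.
rewrite opprB addrCA addrC; apply; case: k => k /=; lia.
Qed.

(** Steps of 2 form one cycle for odd n and two for even n; two base points at an odd offset reach
    everything in both cases. *)
Lemma ord_ind2 (Q : pred 'I_p.+3) x q : Q x -> Q (x + (2 * q + 1)%:R) ->
  (forall y, Q y -> Q (y + 2)) -> forall y, Q y.
Proof.
move=> Qx Qxq Q2 y.
have step z k : Q z -> Q (z + (2 * k)%:R).
  move=> Qz; elim: k => [|k IHk]; first by rewrite addr0.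
  by rewrite mulnSr natrD addrA Q2.
have [k kn ->] := ord_cycle x y.
(* Adding 2qn, which vanishes in Z/n, makes an odd k large enough to be reached from the second base
   point. *)
have kE : k%:R = (k + 2 * (q * p.+3))%:R :> 'I_p.+3.
  by apply/val_inj; rewrite /= !ord_natrE addnC mulnA modnMDl.
have [ok|ek] := boolP (odd k); last first.
  by rewrite (_ : k = 2 * k./2)%N ?step //; lia.
rewrite kE (_ : k + _ = 2 * q + 1 + 2 * (k./2 + q * p.+2))%N.
  by rewrite natrD addrA step.
have := odd_double_half k; rewrite ok; nia.
Qed.

Lemma type_i_tiling (M : {set {set vertex p.+3}}) :
  perfect_matching (P_edges p.+3) M -> type_i M ->
  exists2 A, tiling A & M = tiling_matching A.
Proof.
move=> pM tM; have [d [d0 dS dsp d4]] := dist_last_spoke tM.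
have step x : d (x + 1) = (d x).+1 \/
              [/\ d (x + 1) = 0%N & (4 %| d x)%N].
  have [xM|/dS] := boolP (spoke (x + 1) \in M); last by left.
  by right; rewrite d4 //; split=> //; apply/eqP; rewrite d0.
(* 4-tiles start at the first, fifth, ninth... cell after a spoke; gaps being multiples of 4, the
   last one ends just before the next spoke. *)
pose A := [set x | d x %% 4 == 1]%N.
have d1 x : d x = (d (x - 1)).+1 \/ [/\ d x = 0%N & (4 %| d (x - 1)%R)%N].
  by have := step (x - 1); rewrite subrK.
have d2 x : d (x - 1) = (d (x - 2)).+1 \/
    [/\ d (x - 1) = 0%N & (4 %| d (x - 2)%R)%N].
  by have := d1 (x - 1); rewrite (_ : x - 1 - 1 = x - 2) //; ring.
have d3 x : d (x - 2) = (d (x - 3)).+1 \/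
    [/\ d (x - 2) = 0%N & (4 %| d (x - 3)%R)%N].
  by have := d1 (x - 2); rewrite (_ : x - 2 - 1 = x - 3) //; ring.
have tA : tiling A.
  apply/tilingP=> x; rewrite !inE.
  have := d1 (x + 3); have := d2 (x + 3); have := d3 (x + 3).
  rewrite (_ : x + 3 - 1 = x + 2); last by ring.
  rewrite (_ : x + 3 - 2 = x + 1); last by ring.
  rewrite addrK => h1 h2 h3 hx; split; lia.
have SA x : (spoke x \in M) = (x \in monomers A).
  rewrite -d0 inE /boundary !inE; have := d1 x; have := d2 x; have := d3 x; lia.
exists A => //.
have /(perfect_matching_degP _ p1)[sM HM] := pM.
have /(perfect_matching_degP _ p1)[sN HN] := tiling_matching_perfect tA.
(* Both matchings have degree 1 at u_(x+2) and the same spokes, so agreement on one u-edge there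
   forces agreement on the other. *)
have Estep x : (u_edge x \in M) = (u_edge x \in tiling_matching A) ->
    (u_edge (x + 2) \in M) = (u_edge (x + 2) \in tiling_matching A).
  case: (HM (x + 2)) (HN (x + 2)) => [+ _] [+ _].
  rewrite addrK spoke_tiling SA => + + e; rewrite e.
  by do 4!case: (_ \in _).
have Fstep x : (v_edge x \in M) = (v_edge x \in tiling_matching A) ->
    (v_edge (x + 1) \in M) = (v_edge (x + 1) \in tiling_matching A).
  case: (HM (x + 1)) (HN (x + 1)) => [_ +] [_ +].
  rewrite addrK spoke_tiling SA => + + e; rewrite e.
  by do 4!case: (_ \in _).
(* A spoke excludes the other edges at its ends in both matchings; this starts the propagation. *)
have EFspoke x : spoke x \in M ->
    (u_edge x \in M) = (u_edge x \in tiling_matching A) /\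
    (v_edge x \in M) = (v_edge x \in tiling_matching A).
  move=> xM; case: (HM x) (HN x) => [+ +] [+ +].
  have one (a b c e : bool) : (true + a + b = 1 -> true + c + e = 1 -> a = c)%N.
    by case: a b c e => [] [] [] [].
  rewrite spoke_tiling -SA xM => h1 h2 h3 h4; split.
    exact: one h1 h3.
  exact: one h2 h4.
case/andP: (tM) => /existsP[z zM] _.
have F x : (v_edge x \in M) = (v_edge x \in tiling_matching A).
  have [k _ ->] := ord_cycle z x; elim: k => [|k IHk].
    by rewrite addr0; have [] := EFspoke z zM.
  by rewrite -natr1 addrA; apply: Fstep.
have E x : (u_edge x \in M) = (u_edge x \in tiling_matching A).
  (* The spoke preceding z, possibly z itself after a full turn, is at z - (4q + 1); this odd
     distance gives the parameter [2 * q] of [ord_ind2]. *)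
  have := d4 (z - 1); rewrite subrK => /(_ zM)/dvdnP[q eq].
  have := dsp (z - 1); rewrite eq => yM.
  apply/eqP; move: x; apply: (@ord_ind2 _ (z - 1 - (q * 4)%:R) (2 * q)).
  - by apply/eqP; have [] := EFspoke _ yM.
  - rewrite natrD addrA mulnA (mulnC q) subrK subrK.
    by apply/eqP; have [] := EFspoke z zM.
  - by move=> y /eqP e; apply/eqP/Estep.
apply: eq_matching => // x; by rewrite spoke_tiling SA.
Qed.

(** Type (i) matchings come from the tilings with a monomer, type (ii) from those without. *)
Lemma M1_tilings : [set M | perfect_matching (P_edges p.+3) M &&
    (type_i M || type_ii M)] =
  [set tiling_matching A | A in [set A | tiling A]].
Proof.
apply/setP=> M; rewrite inE; apply/andP/imsetP=> [[pM]|[A]].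
  case/orP=> [/(type_i_tiling pM)[A tA ->]|/and3P[_ n4 /existsP[i /eqP->]]].
    by exists A; rewrite ?inE.
  by exists (periodic i); rewrite ?inE ?periodic_tiling ?type_ii_matchingE.
rewrite inE => tA ->; split; first exact: tiling_matching_perfect.
have [m0|mN0] := eqVneq (monomers A) set0; last by rewrite tiling_type_i.
apply/orP; right.
have [a aA] : exists a, a \in A.
  have := tiling_cover 0 tA; rewrite m0 inE.
  case E0: (_ \in _); first by eexists; apply: E0.
  case E1: (_ \in _); first by eexists; apply: E1.
  case E2: (_ \in _); first by eexists; apply: E2.
  by case E3: (_ \in _) => // _; eexists; apply: E3.
(* A full turn brings the start a back to itself, so n is a multiple of the period 4. *)
have n4 : (4 %| p.+3)%N.
  rewrite -(tiling_no_monomer _ tA m0 aA) (_ : p.+3%:R = 0) ?addr0 //.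
  by apply/eqP; rewrite ord_natr_eq0.
apply/and3P; split=> //.
  by apply/forallP=> x; rewrite spoke_tiling m0 inE.
apply/existsP; exists a; rewrite type_ii_matchingE //; apply/eqP.
congr tiling_matching.
apply/setP=> x; have [k _ ->] := ord_cycle a x.
by rewrite mem_periodic // (tiling_no_monomer _ tA m0 aA).
Qed.

End Matchings.

(** * Tilings of a segment, as words *)

Section Words.
Local Open Scope nat_scope.

Definition add_tile (s : bitseq) : bitseq := [:: true, false, false, false & s].

(* The words of [l] monomers and [m] 4-tiles, [true] marking the first cell of
   a 4-tile. *)
Fixpoint words (m : nat) : nat -> seq bitseq :=
  if m is m'.+1 then
    fix loop l := [seq add_tile s | s <- words m' l] ++
      (if l is l'.+1 then [seq false :: s | s <- loop l'] else [::])
  else fun l => [:: nseq l false].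

Lemma words_S0 m : words m.+1 0 = [seq add_tile s | s <- words m 0].
Proof. by rewrite /= cats0. Qed.

Lemma words_SS m l : words m.+1 l.+1 =
  [seq add_tile s | s <- words m l.+1] ++ [seq false :: s | s <- words m.+1 l].
Proof. by []. Qed.

(** Pascal's rule, according to the first tile. *)
Lemma size_words m l : size (words m l) = 'C(l + m, l).
Proof.
elim: m l => [|m IHm] l; first by rewrite addn0 binn.
elim: l => [|l IHl]; first by rewrite words_S0 size_map IHm !bin0.
by rewrite words_SS size_cat !size_map IHm IHl !addSn !addnS binS.
Qed.

Lemma words_uniq m l : uniq (words m l).
Proof.
elim: m l => [//|m IHm]; elim=> [|l IHl].
  by rewrite words_S0 map_inj_uniq ?IHm // => s t [].
rewrite words_SS cat_uniq !map_inj_uniq ?IHm ?IHl //; try by move=> s t [].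
by rewrite andbT; apply/hasPn=> _ /mapP[s _ ->]; apply/mapP=> -[].
Qed.

(** The bound on i + 3 is explicit because [nth] returns [false] past the end: a 4-tile must not
    overhang the word. *)
Definition word_tiling (s : bitseq) := forall i, nth false s i ->
  [/\ i + 3 < size s, ~~ nth false s (i + 1), ~~ nth false s (i + 2)
    & ~~ nth false s (i + 3)].

Lemma word_tiling_false s : word_tiling (false :: s) <-> word_tiling s.
Proof. by split=> H i; [apply: (H i.+1)|case: i => [//|i]; apply: (H i)]. Qed.

Lemma word_tiling_add s : word_tiling (add_tile s) <-> word_tiling s.
Proof.
split=> H i; first exact: (H i.+4).
by case: i => [|[|[|[|i]]]] //; apply: (H i).
Qed.

Lemma word_tiling_true s :
  word_tiling (true :: s) -> exists t, true :: s = add_tile t.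
Proof.
move=> /(_ 0 isT) /=.
by case: s => [|[] [|[] [|[] t]]] [] //; exists t.
Qed.

Lemma word_tiling_count s : word_tiling s -> 4 * count id s <= size s.
Proof.
have [k] := ubnP (size s); elim: k s => // k IHk [|[] s] //= ks.
  move=> /[dup] /word_tiling_true[t [es]]; rewrite es => /word_tiling_add/IHk.
  by rewrite es /= in ks *; lia.
by move=> /word_tiling_false/IHk; lia.
Qed.

Lemma mem_words m l s : s \in words m l <->
  [/\ word_tiling s, size s = l + 4 * m & count id s = m].
Proof.
split.
  elim: m l s => [|m IHm] l s.
    rewrite inE => /eqP->; rewrite size_nseq muln0 addn0; split=> //.
      by move=> i; rewrite nth_nseq if_same.
    by rewrite count_nseq.
  elim: l s => [|l IHl] s.
    rewrite words_S0 => /mapP[t /IHm[tt st ct] ->].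
    by split; [apply/word_tiling_add|rewrite /= st; lia|rewrite /= ct].
  rewrite words_SS mem_cat => /orP[] /mapP[t].
    move=> /IHm[tt st ct] ->.
    by split; [apply/word_tiling_add|rewrite /= st; lia|rewrite /= ct].
  move=> /IHl[tt st ct] ->.
  by split; [apply/word_tiling_false|rewrite /= st; lia|rewrite /= ct].
elim: m l s => [|m IHm] l s.
  rewrite muln0 addn0 => -[_ <- /eqP]; rewrite -leqn0 leqNgt -has_count => nt.
  rewrite inE; apply/eqP; rewrite -[s]map_id.
  elim: s nt => //= b s IHs; rewrite negb_or => /andP[/negPf-> /IHs e].
  by rewrite {1}e.
have addP k t : [/\ word_tiling (true :: t), size (true :: t) = k + 4 * m.+1
      & count id (true :: t) = m.+1] ->
    true :: t \in [seq add_tile t' | t' <- words m k].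
  case=> /[dup] /word_tiling_true[t' ->] /word_tiling_add wt /= st [ct].
  by apply: map_f; apply: IHm; split=> //; lia.
elim: l s => [|l IHl] [|c s] H; try by case: H => _ /=; lia.
  rewrite words_S0; case: c H => H; first by apply: addP.
  (* With l = 0, an initial monomer would leave only 4m + 3 cells for m + 1 4-tiles. *)
  by case: H => /word_tiling_false/word_tiling_count /=; lia.
rewrite words_SS mem_cat; case: c H => H; first by rewrite addP.
case: H => /word_tiling_false ws /= ss cs.
by rewrite orbC map_f //; apply: IHl; split=> //; lia.
Qed.

End Words.

(** * Counting the tilings of the cycle *)

Section Counting.

Variable p : nat.
Implicit Types (x y : 'I_p.+3) (A : {set 'I_p.+3}).

Definition word_from x A : bitseq := mkseq (fun k => x + k%:R \in A) p.+3.

Lemma nth_word_from x A i :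
  nth false (word_from x A) i = (i < p.+3)%N && (x + i%:R \in A).
Proof.
have [ip|pi] := ltnP i p.+3; first by rewrite nth_mkseq.
by rewrite nth_default // size_mkseq.
Qed.

Lemma word_from_inj x : injective (word_from x).
Proof.
move=> A A' e; apply/setP=> y; have [k kn ->] := ord_cycle x y.
by have := nth_word_from x A' k; rewrite -e nth_word_from kn.
Qed.

Lemma count_word_from x A : count id (word_from x A) = #|A|.
Proof.
rewrite count_map -sum1_count -{1}[p.+3]subn0 -/(index_iota _ _) big_mkord.
rewrite -sum1_card [RHS](reindex (fun k => x + k)) /=.
  by apply: eq_bigl => k /=; rewrite natr_Zp.
by exists (fun y => y - x) => y _; rewrite /= [LHS]addrC ?addKr ?subrK.
Qed.

(** Cutting the cycle before x leaves every 4-tile whole exactly when none crosses the cut, that is,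
    when x is a boundary. *)
Lemma word_tiling_from x A :
  word_tiling (word_from x A) <-> tiling A && boundary A x.
Proof.
(* The cells x - 1, x - 2, x - 3 are the last three letters of the word. *)
have eB j : (0 < j <= 3)%N -> x - j%:R = x + (p.+3 - j)%:R.
  move=> j3; rewrite natrB; last by lia.
  by rewrite -[p.+3]add0n ord_natrD_n sub0r.
rewrite /boundary (eB 1%N) // !eB //.
split=> [W|/andP[/tilingP tA /and3P[b1 b2 b3]] i].
  have nA j : (0 < j <= 3)%N -> x + (p.+3 - j)%:R \notin A.
    move=> j3; apply/negP=> jA; have := W (p.+3 - j)%N.
    rewrite nth_word_from jA size_mkseq => /(_ _)[]; lia.
  rewrite !nA // !andbT; apply/tilingP=> y.
  have [k kn ->] := ord_cycle x y => kA.
  have := W k; rewrite !nth_word_from kn kA size_mkseq => /(_ isT)[k3].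
  rewrite !(natrD _ k) ![x + (k%:R + _)]addrA.
  by rewrite !(leq_ltn_trans _ k3) ?leq_add2l.
rewrite !nth_word_from size_mkseq => /andP[ip iA].
have i3 : (i + 3 < p.+3)%N.
  rewrite ltnNge; apply/negP=> pi.
  have : [|| i == p.+3 - 1, i == p.+3 - 2 | i == p.+3 - 3]%N by lia.
  by case/or3P=> /eqP ei; rewrite ei ?(negPf b1) ?(negPf b2) ?(negPf b3) in iA.
rewrite i3 !(natrD _ i) ![x + (i%:R + _)]addrA.
by case: (tA _ iA) => /negPf-> /negPf-> /negPf->; rewrite !andbF.
Qed.

Lemma word_from_surj x s : size s = p.+3 -> exists A, s = word_from x A.
Proof.
move=> ss; exists [set y | nth false s (nat_of_ord (y - x))].
apply: (@eq_from_nth _ false); first by rewrite size_mkseq.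
move=> i; rewrite ss => ip.
by rewrite nth_word_from ip inE addrC addKr ord_natrE modn_small.
Qed.

Lemma card_tilings_from x m l : (l + 4 * m = p.+3)%N ->
  #|[set A | [&& tiling A, boundary A x & #|A| == m]]| = 'C(l + m, l).
Proof.
move=> lm; rewrite -size_words cardE -(size_map (word_from x)).
apply/perm_size/uniq_perm; last 1 first.
- move=> s; apply/mapP/idP=> [[A + ->]|/mem_words[ws ss cs]].
    rewrite mem_enum inE andbA => /andP[/word_tiling_from wA /eqP cA].
    by apply/mem_words; rewrite size_mkseq count_word_from.
  have [|A e] := @word_from_surj x s; first by rewrite ss.
  exists A => //; rewrite mem_enum inE andbA; apply/andP; split.
    by apply/word_tiling_from; rewrite -e.
  by rewrite -(count_word_from x) -e cs.
- by rewrite map_inj_uniq ?enum_uniq //; apply: word_from_inj.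
exact: words_uniq.
Qed.

Lemma sum_translate A y : (\sum_x (x - y \in A)%R = #|A|)%N.
Proof.
rewrite -sum1_card [RHS]big_mkcond [RHS](reindex (fun x => x - y)) /=.
  by apply: eq_bigr => x _; case: ifP.
by exists (fun x => x + y) => x _; rewrite ?addrK ?subrK.
Qed.

(** Sum [tiling_cover] over x: each of the four translates of [A] contributes [#|A|]. *)
Lemma card_monomers A : tiling A -> (#|monomers A| + 4 * #|A| = p.+3)%N.
Proof.
move=> tA.
have sum0 (B : {set 'I_p.+3}) : (\sum_x (x \in B) = #|B|)%N.
  by rewrite -(sum_translate B 0); under [RHS]eq_bigr do rewrite subr0.
have sum1 : (\sum_(x : 'I_p.+3) 1 = p.+3)%N by rewrite sum1_card card_ord.
rewrite -[RHS]sum1 -[RHS](eq_bigr _ (fun x _ => tiling_cover x tA)).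
by rewrite !big_split /= !sum_translate !sum0 -!addnA !mulSn addn0.
Qed.

(** Boundaries are the first cells of the tiles, monomers and 4-tiles alike. *)
Lemma card_boundaries A :
  tiling A -> #|[set x | boundary A x]| = (#|monomers A| + #|A|)%N.
Proof.
move=> tA; rewrite addnC -cardsUI [X in _ = (_ + X)%N](_ : _ = 0%N).
  rewrite addn0; apply: eq_card => x; rewrite !inE.
  by have [/(tiling_boundary tA)->|] := boolP (x \in A).
apply/eqP; rewrite cards_eq0; apply/eqP/setP=> x; rewrite !inE.
by case: (x \in A).
Qed.

(** Counts the pairs of a tiling [A] and a boundary x of [A], first by [A], then by x. *)
Lemma card_tilings_mul m l : (l + 4 * m = p.+3)%N ->
  (#|[set A : {set 'I_p.+3} | tiling A && (#|A| == m)]| * (l + m)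
     = p.+3 * 'C(l + m, l))%N.
Proof.
move=> lm; transitivity (\sum_(A : {set 'I_p.+3} | tiling A && (#|A| == m))
    #|[set x | boundary A x]|)%N.
  rewrite -sum_nat_const; apply: eq_big => A; rewrite inE //.
  case/andP=> tA /eqP cA; rewrite card_boundaries // cA.
  by have := card_monomers tA; rewrite cA; lia.
under eq_bigr do rewrite -sum1_card.
rewrite (exchange_big_dep xpredT) //= -[p.+3 in RHS]card_ord -sum_nat_const.
apply: eq_bigr => x _; rewrite sum1_card -(card_tilings_from x lm).
by apply: eq_card => A; rewrite unfold_in !inE andbAC andbA.
Qed.

(** Tilings are sorted by their number l of monomers; as n - l is four times the number of 4-tiles,
    the class is empty unless 4 divides n - l. *)
Lemma card_tilings :
  (#|[set A : {set 'I_p.+3} | tiling A]|%:R : rat) =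
  \sum_(0 <= l < p.+4 | (4 %| p.+3 - l)%N)
     (p.+3%:R / (l + (p.+3 - l) %/ 4)%N%:R) * ('C(l + (p.+3 - l) %/ 4, l))%:R.
Proof.
have lt A : (#|monomers A| < p.+4)%N.
  by have := max_card (mem (monomers A)); rewrite card_ord.
rewrite -sum1_card (partition_big (fun A => Ordinal (lt A)) xpredT) //=.
rewrite big_mkord natr_sum [RHS]big_mkcond /=; apply: eq_bigr => l _.
rewrite sum1_card; case: ifP => [l4|nl4].
  set m := ((p.+3 - l) %/ 4)%N.
  have lm : (l + 4 * m = p.+3)%N by have := ltn_ord l; lia.
  rewrite (@eq_card _ _ [set A : {set 'I_p.+3} | tiling A && (#|A| == m)]).
    rewrite mulrAC -natrM -(card_tilings_mul lm) natrM mulfK //.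
    (* The denominator l + m is nonzero since l + 4m = n >= 3. *)
    by rewrite pnatr_eq0; lia.
  move=> A; rewrite [in LHS]unfold_in !inE -val_eqE /=.
  case tA: (tiling A) => //=.
  have := card_monomers tA; move: #|A| #|monomers A| => a b; lia.
rewrite (@eq_card0 _ _) // => A; rewrite [in LHS]unfold_in !inE -val_eqE /=.
apply/negP.
case/andP=> /card_monomers eA /eqP mA.
by move: nl4; rewrite -{1}eA -mA addKn dvdn_mulr.
Qed.

End Counting.

(** * The case n = 4 and the conclusion *)

Lemma card_M1_4 : #|M1_4| = 2%N.
Proof.
rewrite /M1_4; set M := [set _; _; _; _]; rewrite cards2.
suff -> : [set spoke i | i : 'I_4] != M by [].
(* A spoke separates the two matchings. *)
apply/eqP=> /setP/(_ (spoke ord0)); rewrite imset_f // !inE.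
have nu (x y z : 'I_4) : spoke x != [set u y; u z].
  by apply/eqP=> /setP/(_ (v x)); rewrite !inE eqxx.
have nv (x y z : 'I_4) : spoke x != [set v y; v z].
  by apply/eqP=> /setP/(_ (u x)); rewrite !inE eqxx.
by rewrite !(negPf (nu _ _ _)) !(negPf (nv _ _ _)).
Qed.

Unset Implicit Arguments.

Theorem theorem2p1 (n : nat) (hn : (3 <= n)%N) :
  (#|M1 n|%:R : rat) =
  if n == 4%N then 2%:R
  else \sum_(0 <= l < n.+1 | (4 %| n - l)%N)
         (n%:R / (l + (n - l) %/ 4)%N%:R) * ('C(l + (n - l) %/ 4, l))%:R.
Proof.
case: eqP => [->|/eqP n4]; first by rewrite card_M1_4.
case: n n4 hn => [|[|[|p]]] // n4 _; rewrite -card_tilings.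
have p1 : p != 1%N by [].
(* [M1] reduces to its general branch only after enough case analysis on p to see that n is not
   4. *)
rewrite (_ : M1 p.+3 = [set M | perfect_matching (P_edges p.+3) M &&
  (type_i M || type_ii M)]); last by case: p n4 {p1} => [|[|p]].
rewrite M1_tilings // card_in_imset // => A A'; rewrite !inE.
exact: (tiling_matching_inj p1).
Qed.
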